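(* Let $\Gamma$ be an abelian group, let $R$ and $S$ be $\Gamma$-graded rings, let $M$ be a $\Gamma$-graded $R$–$S$-bimodule, and assume that $M$ and $S$ are graded isomorphic as graded right $S$-modules. Let $\mathcal{F}_M=-\otimes_R M:\mathrm{Gr}\text{-}R\to\mathrm{Gr}\text{-}S$. Then there exists a graded unital ring homomorphism $\xi:R\to S$ such that $K_0^{\mathrm{gr}}(\xi)=K_0^{\mathrm{gr}}(\mathcal{F}_M)$ as maps $K_0^{\mathrm{gr}}(R)\to K_0^{\mathrm{gr}}(S)$. Moreover, if $\mathcal{F}_M$ is a graded equivalence, then $\xi:R\to S$ is a graded isomorphism of rings.
   Context: Rings are unital and modules are unitary. A ring $R=\bigoplus_{\gamma\in\Gamma}R_\gamma$ is $\Gamma$-graded if $R_\gamma R_\eta\subseteq R_{\gamma+\eta}$; a $\Gamma$-graded $R$–$S$-bimodule is a bimodule $M=\bigoplus_\gamma M_\gamma$ with $R_\gamma M_\eta S_\zeta\subseteq M_{\gamma+\eta+\zeta}$. Graded ring homomorphisms and graded isomorphisms of modules preserve degrees. $\mathrm{Gr}\text{-}R$ is the category of graded right $R$-modules with degree-preserving homomorphisms; $M(\gamma)$ denotes the shifted module $M(\gamma)_\eta=M_{\gamma+\eta}$, and $\mathcal{T}_\gamma:M\mapsto M(\gamma)$ is the shift functor. The tensor product $X\otimes_R M$ is graded by $\deg(x\otimes m)=\deg x+\deg m$ on homogeneous elements. A functor $\mathcal{F}:\mathrm{Gr}\text{-}R\to\mathrm{Gr}\text{-}S$ is graded if it commutes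 with the shift functors, $\mathcal{F}(M(\gamma))=\mathcal{F}(M)(\gamma)$ for all $\gamma$; it is a graded equivalence if there is a graded functor $\mathcal{G}:\mathrm{Gr}\text{-}S\to\mathrm{Gr}\text{-}R$ with $\mathcal{G}\mathcal{F}$ and $\mathcal{F}\mathcal{G}$ naturally isomorphic to the identity functors. $K_0^{\mathrm{gr}}(R)$ is the group completion of the monoid of graded isomorphism classes of finitely generated graded projective right $R$-modules under $\oplus$. Here $K_0^{\mathrm{gr}}(\mathcal{F}_M)[X]=[X\otimes_R M]$, and $K_0^{\mathrm{gr}}(\xi)[X]=[X\otimes_\xi S]$, where $S$ is a left $R$-module via $r\cdot s=\xi(r)s$. *)

(* Defs.v *)
From HB Require Import structures.
From mathcomp Require Import all_boot all_algebra ssrAC.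
From mathcomp Require Import boolp.

Set Implicit Arguments.
Unset Strict Implicit.
Unset Printing Implicit Defensive.

Import GRing.Theory.
Local Open Scope ring_scope.
Local Open Scope quotient_scope.

(* [C] exhibits [V] as the internal direct sum of the subgroups [C g]. *)
Record is_grading (G V : zmodType) (C : G -> V -> Prop) : Prop := IsGrading {
  grading0 : forall g, C g 0;
  gradingB : forall g x y, C g x -> C g y -> C g (x - y);
  grading_span : forall x, exists2 l : seq V,
    (forall v, v \in l -> exists g, C g v) & x = \sum_(v <- l) v;
  grading_free : forall (s : seq G) (f : G -> V), uniq s ->
    (forall g, C g (f g)) -> \sum_(g <- s) f g = 0 ->
    forall g, g \in s -> f g = 0 }.

Section GradingTheory.
Variables (G V : zmodType) (C : G -> V -> Prop) (gC : is_grading C).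

Lemma gradingN g x : C g x -> C g (- x).
Proof. by move=> Cx; rewrite -sub0r; apply: (gradingB gC) => //; apply: grading0. Qed.

Lemma gradingD g x y : C g x -> C g y -> C g (x + y).
Proof. by move=> Cx Cy; rewrite -[y]opprK; apply: (gradingB gC) => //; apply: gradingN. Qed.

Lemma grading_sum (I : eqType) (r : seq I) (P : pred I) (F : I -> V) g :
  (forall i, i \in r -> P i -> C g (F i)) -> C g (\sum_(i <- r | P i) F i).
Proof.
move=> H; rewrite big_seq_cond; apply: big_ind => [|x y|i /andP[]].
- exact: grading0.
- exact: gradingD.
- exact: H.
Qed.

Definition is_dec (x : V) (d : seq G * (G -> V)) : Prop :=
  [/\ uniq d.1, forall g, C g (d.2 g), forall g, g \notin d.1 -> d.2 g = 0
    & x = \sum_(g <- d.1) d.2 g].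

Lemma dec_widen x s f t : is_dec x (s, f) -> uniq t -> {subset s <= t} ->
  x = \sum_(g <- t) f g.
Proof.
case=> /= us _ f0 -> ut st.
rewrite (bigID (mem s) predT) /= [in RHS](bigID (mem s)) /=; congr (_ + _).
  rewrite -[LHS]big_filter -[RHS]big_filter; apply: perm_big.
  apply: uniq_perm; rewrite ?filter_uniq // => g.
  by rewrite !mem_filter; case sg: (g \in s) => //=; rewrite st.
by rewrite !big1 // => g /f0.
Qed.

Lemma dec_uniq x d e : is_dec x d -> is_dec x e -> d.2 =1 e.2.
Proof.
case: d => s f; case: e => t h df dh g /=.
pose u := undup (s ++ t).
have uu : uniq u by apply: undup_uniq.
have e1 : x = \sum_(g <- u) f g.
  by apply: (dec_widen df) => // i si; rewrite mem_undup mem_cat si.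
have e2 : x = \sum_(g <- u) h g.
  by apply: (dec_widen dh) => // i si; rewrite mem_undup mem_cat si orbT.
have [/= _ Cf f0 _] := df; have [/= _ Ch h0 _] := dh.
case gu: (g \in u); last first.
  move: gu; rewrite mem_undup mem_cat => /negbT; rewrite negb_or => /andP[gs gt].
  by rewrite (f0 g gs) (h0 g gt).
apply/eqP; rewrite -subr_eq0; apply/eqP.
apply: (@grading_free _ _ _ gC u (fun g => f g - h g)) => //.
  by move=> k; apply: (gradingB gC).
by rewrite big_split /= sumrN -e1 -e2 subrr.
Qed.

Lemma dec_add x y d e : is_dec x d -> is_dec y e ->
  is_dec (x + y) (undup (d.1 ++ e.1), fun g => d.2 g + e.2 g).
Proof.
case: d => s f; case: e => t h df dh.
have [/= _ Cf f0 _] := df; have [/= _ Ch h0 _] := dh.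
split => /=.
- exact: undup_uniq.
- by move=> g; apply: gradingD; [apply: Cf|apply: Ch].
- move=> g; rewrite mem_undup mem_cat negb_or => /andP[gs gt].
  by rewrite (f0 g gs) (h0 g gt) addr0.
rewrite big_split /=; congr (_ + _).
  by apply: (dec_widen df) => [|g gs]; rewrite ?undup_uniq // mem_undup mem_cat gs.
by apply: (dec_widen dh) => [|g gs]; rewrite ?undup_uniq // mem_undup mem_cat gs orbT.
Qed.

Lemma dec_homog g x : C g x -> is_dec x ([:: g], fun h => if h == g then x else 0).
Proof.
move=> Cx; split=> //= [h|h|].
- by case: eqP => [->|_] //; apply: grading0.
- by rewrite inE => /negbTE ->.
by rewrite big_seq1 eqxx.
Qed.

Lemma grading_ind (P : V -> Prop) : P 0 ->
  (forall x y, P x -> P y -> P (x + y)) -> (forall g x, C g x -> P x) ->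
  forall x, P x.
Proof.
move=> P0 PD P1 x; have [l Cl ->] := grading_span gC x.
by rewrite big_seq; apply: big_ind => // v /Cl [g]; apply: P1.
Qed.

Lemma dec_ex x : exists d, is_dec x d.
Proof.
have [l Cl ->] := grading_span gC x.
elim: l Cl => [|v l IH] Cl.
  exists ([::], fun _ => 0); split=> //=; last by rewrite !big_nil.
  by move=> g; apply: grading0.
have [d dl] : exists d, is_dec (\sum_(v <- l) v) d.
  by apply: IH => w wl; apply: Cl; rewrite inE wl orbT.
have [g Cv] := Cl v (mem_head _ _).
by rewrite big_cons; eexists; apply: dec_add; [apply: dec_homog Cv|apply: dl].
Qed.

Definition gr_supp x : seq G := (sval (cid (dec_ex x))).1.
Definition gr_proj g x : V := (sval (cid (dec_ex x))).2 g.

Lemma gr_decP x : is_dec x (gr_supp x, gr_proj^~ x).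
Proof. by rewrite /gr_supp /gr_proj; case: cid => -[s f]. Qed.

Lemma gr_projP g x : C g (gr_proj g x).
Proof. by have [_ /(_ g)] := gr_decP x. Qed.

Lemma gr_projD g : {morph gr_proj g : x y / x + y}.
Proof.
move=> x y.
exact: (dec_uniq (gr_decP (x + y)) (dec_add (gr_decP x) (gr_decP y))).
Qed.

Lemma gr_proj_homog g h x : C h x -> gr_proj g x = if g == h then x else 0.
Proof. by move=> Cx; apply: (dec_uniq (gr_decP x) (dec_homog Cx)). Qed.

Lemma gr_proj_id g x : C g x -> gr_proj g x = x.
Proof. by move=> Cx; rewrite (gr_proj_homog g Cx) eqxx. Qed.

Lemma gr_sum_proj x s : uniq s -> {subset gr_supp x <= s} ->
  x = \sum_(g <- s) gr_proj g x.
Proof. by move=> us ss; apply: (dec_widen (gr_decP x)). Qed.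

Lemma gr_supp_uniq x : uniq (gr_supp x).
Proof. by case: (gr_decP x). Qed.

Lemma gr_proj0 g x : g \notin gr_supp x -> gr_proj g x = 0.
Proof. by case: (gr_decP x) => _ _ /(_ g). Qed.

End GradingTheory.

Lemma grading_by_proj (G V : zmodType) (C : G -> V -> Prop) (p : G -> V -> V) :
  (forall g, C g 0) -> (forall g x y, C g x -> C g y -> C g (x - y)) ->
  (forall x, exists2 l : seq V,
    (forall v, v \in l -> exists g, C g v) & x = \sum_(v <- l) v) ->
  (forall g, {morph p g : x y / x + y}) ->
  (forall g h x, C h x -> p g x = if g == h then x else 0) ->
  is_grading C.
Proof.
move=> C0 CB Cs pD pH; split=> // s f us Cf sf0 g gs.
have p0 : p g 0 = 0 by rewrite (pH g g) // eqxx.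
have: p g (\sum_(g <- s) f g) = \sum_(h <- s) p g (f h) by apply: (big_morph _ (pD g) p0).
rewrite sf0 p0 (bigD1_seq g) //= (pH g g) // eqxx big1 ?addr0 // => h hg.
by rewrite (pH g h) // eq_sym (negbTE hg).
Qed.

Record grRing (G : zmodType) := GrRing {
  gr_ring :> pzRingType;
  ring_comp : G -> gr_ring -> Prop;
  ring_grading : is_grading ring_comp;
  ring_compM : forall g h x y,
    ring_comp g x -> ring_comp h y -> ring_comp (g + h) (x * y) }.

Lemma ring_comp1 (G : zmodType) (R : grRing G) : ring_comp 0 (1 : R).
Proof.
have gR := ring_grading R; pose p := gr_proj gR.
have p00 h : p h 0 = 0 by apply: gr_proj_id; apply: grading0.
have pM h (x y : R) : ring_comp h x -> p h (x * y) = x * p 0 y.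
  move=> Cx; elim/(grading_ind gR): y => [|y z IHy IHz|k y Cy].
  - by rewrite mulr0 !p00 mulr0.
  - by rewrite mulrDr /p !gr_projD -/p IHy IHz mulrDr.
  rewrite /p (gr_proj_homog _ _ (ring_compM Cx Cy)) (gr_proj_homog _ _ Cy).
  rewrite -subr_eq0 opprD addrA subrr add0r oppr_eq0 eq_sym.
  by case: eqP => // _; rewrite mulr0.
have p1 (x : R) : x = x * p 0 1.
  elim/(grading_ind gR): x => [|x y IHx IHy|h x Cx]; first by rewrite mul0r.
    by rewrite mulrDl -IHx -IHy.
  by rewrite -(pM h) // mulr1 /p gr_proj_id.
by rewrite [X in ring_comp _ X]p1 mul1r; apply: gr_projP.
Qed.

Record grRingHom (G : zmodType) (R S : grRing G) := GrRingHom {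
  rh_fun :> {rmorphism R -> S};
  rh_deg : forall g x, ring_comp g x -> ring_comp g (rh_fun x) }.

Definition gr_ring_iso (G : zmodType) (R S : grRing G) (xi : grRingHom R S) :=
  exists zeta : grRingHom S R, cancel xi zeta /\ cancel zeta xi.

(* Right [R]-modules are left modules over the converse ring [R^c]:
   [x . r] is [(r : R^c) *: x]. *)
Record grMod (G : zmodType) (R : grRing G) := GrMod {
  gm_mod :> lmodType R^c;
  mod_comp : G -> gm_mod -> Prop;
  mod_grading : is_grading mod_comp;
  mod_compZ : forall g h (x : gm_mod) (r : R),
    mod_comp g x -> ring_comp h r -> mod_comp (g + h) ((r : R^c) *: x) }.

Record grHom (G : zmodType) (R : grRing G) (M N : grMod R) := GrHom {
  gh_fun :> {linear M -> N};
  gh_deg : forall g x, mod_comp g x -> mod_comp g (gh_fun x) }.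

(* A left action of [R] commuting with the right action of [S]. *)
Record left_action (R S : pzRingType) (M : lmodType S^c) := LeftAction {
  lact :> R -> M -> M;
  lact1 : forall m, lact 1 m = m;
  lactA : forall a b m, lact (a * b) m = lact a (lact b m);
  lactDl : forall a b m, lact (a + b) m = lact a m + lact b m;
  lactDr : forall a m n, lact a (m + n) = lact a m + lact a n;
  lactZ : forall a (s : S) m, lact a ((s : S^c) *: m) = (s : S^c) *: lact a m }.

Record grBimod (G : zmodType) (R S : grRing G) := GrBimod {
  gb_mod :> grMod S;
  gb_act : left_action R gb_mod;
  gb_deg : forall g h (r : R) (m : gb_mod),
    ring_comp g r -> mod_comp h m -> mod_comp (g + h) (gb_act r m) }.

Section Category.
Variables (G : zmodType) (R : grRing G).
Implicit Types M N P : grMod R.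

Definition grId M : grHom M M := @GrHom G R M M (@idfun M) (fun g x Cx => Cx).

Definition grComp M N P (g : grHom N P) (f : grHom M N) : grHom M P :=
  @GrHom G R M P (gh_fun g \o gh_fun f)
    (fun k x Cx => gh_deg g (gh_deg f Cx)).

Definition gr_iso M N : Prop :=
  exists (f : grHom M N) (g : grHom N M), cancel f g /\ cancel g f.

Lemma gr_iso_refl M : gr_iso M M.
Proof. by exists (grId M), (grId M). Qed.

Lemma gr_iso_sym M N : gr_iso M N -> gr_iso N M.
Proof. by case=> f [g [fg gf]]; exists g, f. Qed.

Lemma gr_iso_trans M N P : gr_iso M N -> gr_iso N P -> gr_iso M P.
Proof.
case=> f [g [fg gf]] [h [k [hk kh]]]; exists (grComp h f), (grComp g k).
by split=> x /=; rewrite ?hk ?fg ?gf ?kh.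
Qed.

(* [shift g M] is $M(g)$. *)
Lemma shift_grading M g : is_grading (fun h => @mod_comp G R M (g + h)).
Proof.
have gM := mod_grading M.
split=> [h|h x y|x|s f us Cf sf0 h hs].
- exact: grading0.
- exact: gradingB.
- have [l Cl ->] := grading_span gM x; exists l => // v /Cl [k Ck].
  by exists (k - g); rewrite addrC subrK.
pose f' k := f (k - g).
have -> : f h = f' (g + h) by rewrite /f' addrC addKr.
apply: (grading_free gM (s := [seq g + k | k <- s]) (f := f')).
- by rewrite map_inj_uniq //; apply: addrI.
- by move=> k; rewrite /f'; have := Cf (k - g); rewrite addrC subrK.
- by rewrite big_map -[RHS]sf0; apply: eq_bigr => k _; rewrite /f' addrC addKr.
exact: map_f.
Qed.

Lemma shift_compZ M g h k (x : M) (r : R) :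
  mod_comp (g + h) x -> ring_comp k r -> mod_comp (g + (h + k)) ((r : R^c) *: x).
Proof. by move=> Cx Cr; rewrite addrA; apply: mod_compZ. Qed.

Definition shift (g : G) M : grMod R :=
  GrMod (shift_grading M g) (@shift_compZ M g).

Definition shiftHom (g : G) M N (f : grHom M N) : grHom (shift g M) (shift g N) :=
  @GrHom G R (shift g M) (shift g N) f (fun h x Cx => gh_deg f Cx).

End Category.

(* [S] as a graded right module over itself: [(s : S^c) *: x] is [x * s]. *)
Section Regular.
Variables (G : zmodType) (S : grRing G).

Lemma reg_compZ g h (x : (S^c)^o) (s : S) :
  ring_comp g (x : S) -> ring_comp h s -> ring_comp (g + h) ((s : S^c) *: x : S).
Proof. exact: ring_compM. Qed.

Definition grReg : grMod S := @GrMod G S (S^c)^o (@ring_comp G S) (ring_grading S) reg_compZ.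

End Regular.

Section Restriction.
Variables (G : zmodType) (R S : grRing G) (xi : grRingHom R S).

Definition res_lact (r : R) (x : grReg S) : grReg S := xi r * (x : S).

Lemma res_lact1 x : res_lact 1 x = x.
Proof. by rewrite /res_lact rmorph1 mul1r. Qed.
Lemma res_lactA a b x : res_lact (a * b) x = res_lact a (res_lact b x).
Proof. by rewrite /res_lact rmorphM mulrA. Qed.
Lemma res_lactDl a b x : res_lact (a + b) x = res_lact a x + res_lact b x.
Proof. by rewrite /res_lact rmorphD mulrDl. Qed.
Lemma res_lactDr a x y : res_lact a (x + y) = res_lact a x + res_lact a y.
Proof. by rewrite /res_lact mulrDr. Qed.
Lemma res_lactZ a (s : S) x :
  res_lact a ((s : S^c) *: x) = (s : S^c) *: res_lact a x.
Proof. by rewrite /res_lact [LHS]mulrA. Qed.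

Definition res_act : left_action R (grReg S) :=
  LeftAction res_lact1 res_lactA res_lactDl res_lactDr res_lactZ.

Lemma res_deg g h (r : R) (x : grReg S) :
  ring_comp g r -> mod_comp h x -> mod_comp (g + h) (res_act r x).
Proof. by move=> Cr Cx; apply: ring_compM => //; apply: rh_deg. Qed.

Definition grRes : grBimod R S := GrBimod res_deg.

End Restriction.

Section Tensor.
Variables (R S : pzRingType) (X : lmodType R^c) (M : lmodType S^c).
Variable a : left_action R M.

(* A list [:: (x1, m1); ...; (xn, mn)] stands for $\sum_i x_i \otimes m_i$;
   [tens_eq] is the congruence generated by the usual relations, so that the
   quotient, a commutative monoid by construction, is a group because
   $(-x) \otimes m$ is opposite to $x \otimes m$. *)
Inductive tens_eq : seq (X * M) -> seq (X * M) -> Prop :=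
| TensRefl s : tens_eq s s
| TensSym s t : tens_eq s t -> tens_eq t s
| TensTrans s t u : tens_eq s t -> tens_eq t u -> tens_eq s u
| TensCat s s' t t' : tens_eq s s' -> tens_eq t t' -> tens_eq (s ++ t) (s' ++ t')
| TensC s t : tens_eq (s ++ t) (t ++ s)
| Tens0 m : tens_eq [:: (0, m)] [::]
| TensDl x y m : tens_eq [:: (x + y, m)] [:: (x, m); (y, m)]
| TensDr x m n : tens_eq [:: (x, m + n)] [:: (x, m); (x, n)]
| TensA x (r : R) m : tens_eq [:: ((r : R^c) *: x, m)] [:: (x, a r m)].

Definition tens_eqb (s t : seq (X * M)) : bool := `[< tens_eq s t >].

Lemma tens_eqb_refl : reflexive tens_eqb.
Proof. by move=> s; apply/asboolP; apply: TensRefl. Qed.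
Lemma tens_eqb_sym : symmetric tens_eqb.
Proof. by move=> s t; apply/asboolP/asboolP; apply: TensSym. Qed.
Lemma tens_eqb_trans : transitive tens_eqb.
Proof. by move=> t s u /asboolP st /asboolP tu; apply/asboolP; apply: TensTrans st tu. Qed.

Canonical tens_equiv := EquivRel tens_eqb tens_eqb_refl tens_eqb_sym tens_eqb_trans.

Definition tens := {eq_quot tens_equiv}.
HB.instance Definition _ := Choice.on tens.

Definition tpi (s : seq (X * M)) : tens := \pi_{eq_quot tens_equiv} s.

Lemma tpiP s t : tens_eq s t <-> tpi s = tpi t.
Proof.
by split=> [st|/eqmodP/asboolP//]; apply/eqmodP; apply/asboolP.
Qed.

Definition trepr (t : tens) : seq (X * M) := repr (t : {eq_quot tens_equiv}).

Lemma treprK t : tpi (trepr t) = t.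
Proof. exact: reprK. Qed.

Lemma trepr_eq s : tens_eq (trepr (tpi s)) s.
Proof. by apply/tpiP; rewrite treprK. Qed.

Definition tens_zero : tens := tpi [::].
Definition tens_add (t u : tens) : tens := tpi (trepr t ++ trepr u).
Definition tens_opp (t : tens) : tens :=
  tpi [seq (- p.1, p.2) | p <- trepr t].

Lemma tens_addE s t : tens_add (tpi s) (tpi t) = tpi (s ++ t).
Proof. by apply/tpiP; apply: TensCat; apply: trepr_eq. Qed.

Lemma tens_addA : associative tens_add.
Proof.
move=> t u v; rewrite -[t]treprK -[u]treprK -[v]treprK.
by rewrite !tens_addE catA.
Qed.

Lemma tens_addC : commutative tens_add.
Proof.
move=> t u; rewrite -[t]treprK -[u]treprK !tens_addE.
by apply/tpiP; apply: TensC.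
Qed.

Lemma tens_add0 : left_id tens_zero tens_add.
Proof. by move=> t; rewrite -[t]treprK tens_addE. Qed.

Lemma tens_addN : left_inverse tens_zero tens_opp tens_add.
Proof.
move=> t; rewrite /tens_opp -[X in tens_add _ X]treprK tens_addE.
elim: (trepr t) => [//|[x m] s IH] /=.
apply/tpiP; rewrite -cat1s.
apply: (@TensTrans _ ([:: (- x, m); (x, m)] ++ ([seq (- p.1, p.2) | p <- s] ++ s))).
  rewrite /=; apply: (@TensCat [:: _] [:: _]); first exact: TensRefl.
  rewrite -[(x, m) :: s]cat1s -[(x, m) :: (_ ++ _)]cat1s !catA.
  by apply: TensCat; [apply: TensC|apply: TensRefl].
rewrite -[[::]]/([::] ++ [::]); apply: TensCat; last exact/tpiP.
apply: TensTrans (Tens0 m); apply: TensSym.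
by rewrite -[X in (X, m)](addNr x); apply: TensDl.
Qed.

HB.instance Definition _ :=
  GRing.isZmodule.Build tens tens_addA tens_addC tens_add0 tens_addN.

Definition tmk (x : X) (m : M) : tens := tpi [:: (x, m)].

Lemma tpiD s t : tpi (s ++ t) = tpi s + tpi t.
Proof. by rewrite -tens_addE. Qed.

Lemma tpiE s : tpi s = \sum_(p <- s) tmk p.1 p.2.
Proof.
elim: s => [|[x m] s IH]; first by rewrite big_nil.
by rewrite -cat1s tpiD IH big_cat big_seq1.
Qed.

Lemma tensE t : t = \sum_(p <- trepr t) tmk p.1 p.2.
Proof. by rewrite -tpiE treprK. Qed.

Lemma tens_ind (P : tens -> Prop) : P 0 -> (forall x m, P (tmk x m)) ->
  (forall t u, P t -> P u -> P (t + u)) -> forall t, P t.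
Proof. by move=> P0 P1 PD t; rewrite [t]tensE; apply: big_ind. Qed.

Lemma tmkDl x y m : tmk (x + y) m = tmk x m + tmk y m.
Proof. by rewrite -tpiD; apply/tpiP; apply: TensDl. Qed.

Lemma tmkDr x m n : tmk x (m + n) = tmk x m + tmk x n.
Proof. by rewrite -tpiD; apply/tpiP; apply: TensDr. Qed.

Lemma tmkA x (r : R) m : tmk ((r : R^c) *: x) m = tmk x (a r m).
Proof. by apply/tpiP; apply: TensA. Qed.

Lemma tmk0l m : tmk 0 m = 0.
Proof. by apply/tpiP; apply: Tens0. Qed.

Lemma tmk0r x : tmk x 0 = 0.
Proof. by apply: (addrI (tmk x 0)); rewrite -tmkDr !addr0. Qed.

Lemma tmk_suml (I : Type) (r : seq I) (P : pred I) (F : I -> X) m :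
  tmk (\sum_(i <- r | P i) F i) m = \sum_(i <- r | P i) tmk (F i) m.
Proof. by apply: (big_morph (tmk^~ m) (fun x y => tmkDl x y m) (tmk0l m)). Qed.

Lemma tmk_sumr (I : Type) (r : seq I) (P : pred I) (F : I -> M) x :
  tmk x (\sum_(i <- r | P i) F i) = \sum_(i <- r | P i) tmk x (F i).
Proof. by apply: (big_morph (tmk x) (tmkDr x) (tmk0r x)). Qed.

Record balanced (A : zmodType) (b : X -> M -> A) : Prop := Balanced {
  balDl : forall x y m, b (x + y) m = b x m + b y m;
  balDr : forall x m n, b x (m + n) = b x m + b x n;
  balA : forall x (r : R) m, b ((r : R^c) *: x) m = b x (a r m) }.

Definition tlift (A : zmodType) (b : X -> M -> A) (t : tens) : A :=
  \sum_(p <- trepr t) b p.1 p.2.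

Section Lift.
Variables (A : zmodType) (b : X -> M -> A) (bb : balanced b).

Lemma tlift_eq s t : tens_eq s t ->
  \sum_(p <- s) b p.1 p.2 = \sum_(p <- t) b p.1 p.2.
Proof.
elim=> {s t} [//|//|s t u _ -> _ ->//|s s' t t' _ IH1 _ IH2|s t|m|x y m|x m n|x r m].
- by rewrite !big_cat IH1 IH2.
- by rewrite !big_cat /= addrC.
- rewrite big_seq1 big_nil /=; apply: (addrI (b 0 m)).
  by rewrite -(balDl bb) !addr0.
- by rewrite !big_cons !big_nil !addr0 (balDl bb).
- by rewrite !big_cons !big_nil !addr0 (balDr bb).
- by rewrite !big_seq1 (balA bb).
Qed.

Lemma tlift_mk x m : tlift b (tmk x m) = b x m.
Proof. by rewrite /tlift (tlift_eq (trepr_eq _)) big_seq1. Qed.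

Lemma tliftD : {morph tlift b : t u / t + u}.
Proof.
move=> t u; rewrite -[t]treprK -[u]treprK -tpiD /tlift.
by rewrite !(tlift_eq (trepr_eq _)) big_cat.
Qed.

Lemma tlift0 : tlift b 0 = 0.
Proof. by apply: (addrI (tlift b 0)); rewrite -tliftD !addr0. Qed.

End Lift.

Definition tens_scale (s : S^c) : tens -> tens := tlift (fun x m => tmk x (s *: m)).

Lemma tens_scale_bal (s : S^c) : balanced (fun x m => tmk x (s *: m)).
Proof.
split=> [x y m|x m n|x r m]; first exact: tmkDl.
  by rewrite scalerDr tmkDr.
by rewrite tmkA lactZ.
Qed.

Lemma tens_scale_mk s x m : tens_scale s (tmk x m) = tmk x (s *: m).
Proof. exact: tlift_mk (tens_scale_bal s) x m. Qed.

Lemma tens_scaleDr : right_distributive tens_scale +%R.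
Proof. by move=> s t u; apply: tliftD (tens_scale_bal s) t u. Qed.

Lemma tens_scale0 s : tens_scale s 0 = 0.
Proof. exact: tlift0 (tens_scale_bal s). Qed.

Lemma tens_scaleA s s' t : tens_scale s (tens_scale s' t) = tens_scale (s * s') t.
Proof.
elim/tens_ind: t => [|x m|t u IH1 IH2]; first by rewrite !tens_scale0.
  by rewrite !tens_scale_mk scalerA.
by rewrite !tens_scaleDr IH1 IH2.
Qed.

Lemma tens_scale1 : left_id 1 tens_scale.
Proof.
elim/tens_ind => [|x m|t u IH1 IH2]; first by rewrite !tens_scale0.
  by rewrite !tens_scale_mk scale1r.
by rewrite !tens_scaleDr IH1 IH2.
Qed.

Lemma tens_scaleDl t : {morph tens_scale^~ t : s s' / s + s'}.
Proof.
move=> s s'; elim/tens_ind: t => [|x m|t u IH1 IH2].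
- by rewrite !tens_scale0 addr0.
- by rewrite !tens_scale_mk scalerDl tmkDr.
by rewrite !tens_scaleDr IH1 IH2 addrACA.
Qed.

HB.instance Definition _ := GRing.Zmodule_isLmodule.Build S^c tens
  tens_scaleA tens_scale1 tens_scaleDr tens_scaleDl.

Lemma tmkZ (s : S) x m : (s : S^c) *: tmk x m = tmk x ((s : S^c) *: m).
Proof. exact: tens_scale_mk. Qed.

End Tensor.

Arguments tmk {R S X M} a x m.

Section TensorMap.
Variables (R S : pzRingType) (X Y : lmodType R^c) (M : lmodType S^c).
Variables (a : left_action R M) (f : {linear X -> Y}).

Lemma tens_map_bal : balanced a (fun x m => tmk a (f x) m).
Proof.
split=> [x y m|x m n|x r m]; rewrite ?linearD ?tmkDl ?tmkDr //.
by rewrite linearZ tmkA.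
Qed.

Definition tens_map : tens X a -> tens Y a := tlift (fun x m => tmk a (f x) m).

Lemma tens_map_mk x m : tens_map (tmk a x m) = tmk a (f x) m.
Proof. exact: tlift_mk tens_map_bal x m. Qed.

Lemma tens_map_linear : linear tens_map.
Proof.
move=> s t u; rewrite /tens_map (tliftD tens_map_bal); congr (_ + _).
elim/tens_ind: t => [|x m|t v IH1 IH2].
- by rewrite scaler0 (tlift0 tens_map_bal) scaler0.
- by rewrite tmkZ !(tlift_mk tens_map_bal) tmkZ.
by rewrite scalerDr !(tliftD tens_map_bal) IH1 IH2 scalerDr.
Qed.

HB.instance Definition _ :=
  GRing.isLinear.Build S^c (tens X a) (tens Y a) _ tens_map tens_map_linear.

End TensorMap.

Arguments tens_map {R S X Y M} a f _.

Section GradedTensor.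
Variables (G : zmodType) (R S : grRing G) (X : grMod R) (M : grBimod R S).

Local Notation gX := (mod_grading X).
Local Notation gM := (mod_grading M).
Local Notation T := (tens X (gb_act M)).
Local Notation "x *t m" := (tmk (gb_act M) x m) (at level 40).

Definition tens_comp (g : G) (t : T) : Prop :=
  exists2 s : seq (X * M),
    (forall p, p \in s ->
      exists h k, [/\ mod_comp h p.1, mod_comp k p.2 & h + k = g])
    & t = \sum_(p <- s) p.1 *t p.2.

Lemma tens_comp_mk g h x m :
  mod_comp g x -> mod_comp h m -> tens_comp (g + h) (x *t m).
Proof.
move=> Cx Cm; exists [:: (x, m)]; last by rewrite big_seq1.
by move=> p; rewrite inE => /eqP ->; exists g, h.
Qed.

Lemma tens_comp0 g : tens_comp g 0.
Proof. by exists [::]; rewrite ?big_nil. Qed.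

Lemma tens_compB g t u : tens_comp g t -> tens_comp g u -> tens_comp g (t - u).
Proof.
case=> s Cs -> [s' Cs' ->]; exists (s ++ [seq (- p.1, p.2) | p <- s']).
  move=> p; rewrite mem_cat => /orP[/Cs //|/mapP[q /Cs'[h [k [Ch Ck hk]]] ->]].
  by exists h, k; split=> //; apply: (gradingN gX).
rewrite big_cat big_map /=; congr (_ + _); rewrite -sumrN; apply: eq_bigr => p _.
apply: (addrI (p.1 *t p.2)).
by rewrite subrr -tmkDl subrr tmk0l.
Qed.

Definition tens_pr (g : G) (x : X) (m : M) : T :=
  \sum_(h <- gr_supp gX x) gr_proj gX h x *t gr_proj gM (g - h) m.

Lemma tens_prE g x m s : uniq s -> {subset gr_supp gX x <= s} ->
  tens_pr g x m = \sum_(h <- s) gr_proj gX h x *t gr_proj gM (g - h) m.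
Proof.
move=> us ss; rewrite /tens_pr (bigID (mem (gr_supp gX x)) predT (r := s)) /=.
rewrite [X in _ + X]big1 => [|h hx]; last by rewrite gr_proj0 // tmk0l.
rewrite addr0 -[RHS]big_filter; apply: perm_big; apply: uniq_perm.
- exact: gr_supp_uniq.
- by rewrite filter_uniq.
by move=> h; rewrite mem_filter; case hx: (h \in _) => //=; rewrite ss.
Qed.

Lemma tens_prDl g x y m : tens_pr g (x + y) m = tens_pr g x m + tens_pr g y m.
Proof.
pose s := undup (gr_supp gX (x + y) ++ gr_supp gX x ++ gr_supp gX y).
have us : uniq s by apply: undup_uniq.
have [sxy sx sy] : [/\ {subset gr_supp gX (x + y) <= s},
    {subset gr_supp gX x <= s} & {subset gr_supp gX y <= s}].
  by split=> h hs; rewrite mem_undup !mem_cat hs ?orbT.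
rewrite (tens_prE g m us sxy) (tens_prE g m us sx) (tens_prE g m us sy).
by rewrite -big_split; apply: eq_bigr => h _; rewrite gr_projD tmkDl.
Qed.

Lemma tens_prDr g x m n : tens_pr g x (m + n) = tens_pr g x m + tens_pr g x n.
Proof. by rewrite -big_split; apply: eq_bigr => h _; rewrite gr_projD tmkDr. Qed.

Lemma tens_pr_homog g h x m : mod_comp h x ->
  tens_pr g x m = x *t gr_proj gM (g - h) m.
Proof.
move=> Cx; rewrite (@tens_prE g x m (undup (h :: gr_supp gX x))) ?undup_uniq //.
  rewrite (bigD1_seq h) ?undup_uniq ?mem_undup ?mem_head //=.
  rewrite gr_proj_id // big1 ?addr0 // => k /negbTE kh.
  by rewrite (gr_proj_homog gX k Cx) kh tmk0l.
by move=> k kx; rewrite mem_undup inE kx orbT.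
Qed.

Lemma lact0r (r : R) : gb_act M r 0 = 0.
Proof. by apply: (addrI (gb_act M r 0)); rewrite -lactDr !addr0. Qed.

Lemma lact0l m : gb_act M 0 m = 0.
Proof. by apply: (addrI (gb_act M 0 m)); rewrite -lactDl !addr0. Qed.

Lemma gr_proj_0 (V : zmodType) (C : G -> V -> Prop) (gC : is_grading C) g :
  gr_proj gC g 0 = 0.
Proof. by apply: gr_proj_id; apply: grading0. Qed.

Lemma gr_proj_lact g k r m : ring_comp k r ->
  gr_proj gM g (gb_act M r m) = gb_act M r (gr_proj gM (g - k) m).
Proof.
move=> Cr; elim/(grading_ind gM): m => [|m n IH1 IH2|j m Cm].
- by rewrite gr_proj_0 lact0r gr_proj_0.
- by rewrite lactDr !gr_projD IH1 IH2 lactDr.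
rewrite (gr_proj_homog _ _ (gb_deg Cr Cm)) (gr_proj_homog _ _ Cm).
by rewrite subr_eq [j + k]addrC; case: eqP => // _; rewrite lact0r.
Qed.

Lemma tens_pr_bal g : balanced (gb_act M) (tens_pr g).
Proof.
split=> [x y m|x m n|x r m]; [exact: tens_prDl|exact: tens_prDr|].
elim/(grading_ind (ring_grading R)): r => [|r s IHr IHs|k r Cr].
- rewrite scale0r lact0l (tens_pr_homog g _ (grading0 gX 0)) tmk0l.
  rewrite /tens_pr big1 // => h _; by rewrite gr_proj_0 tmk0r.
- by rewrite scalerDl tens_prDl IHr IHs lactDl tens_prDr.
elim/(grading_ind gX): x => [|x y IHx IHy|h x Cx].
- by rewrite scaler0 !(tens_pr_homog g _ (grading0 gX 0)) !tmk0l.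
- by rewrite scalerDr !tens_prDl IHx IHy.
rewrite (tens_pr_homog g _ (mod_compZ Cx Cr)) (tens_pr_homog g _ Cx).
by rewrite tmkA (gr_proj_lact _ _ Cr) opprD addrA.
Qed.

Lemma tens_grading : is_grading tens_comp.
Proof.
apply: (@grading_by_proj _ _ _ (fun g => tlift (tens_pr g))).
- exact: tens_comp0.
- exact: tens_compB.
- elim/tens_ind => [|x m|t u [l Cl ->] [l' Cl' ->]].
  + by exists [::]; rewrite ?big_nil.
  + elim/(grading_ind gX): x => [|x y [l Cl el] [l' Cl' el']|h x Cx].
    * by exists [::]; rewrite ?big_nil ?tmk0l.
    * exists (l ++ l'); last by rewrite big_cat tmkDl el el'.
      by move=> v; rewrite mem_cat => /orP[/Cl|/Cl'].
    elim/(grading_ind gM): m => [|m n [l Cl el] [l' Cl' el']|k m Cm].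
    * by exists [::]; rewrite ?big_nil ?tmk0r.
    * exists (l ++ l'); last by rewrite big_cat tmkDr el el'.
      by move=> v; rewrite mem_cat => /orP[/Cl|/Cl'].
    exists [:: x *t m]; last by rewrite big_seq1.
    by move=> v; rewrite inE => /eqP ->; exists (h + k); apply: tens_comp_mk.
  exists (l ++ l'); last by rewrite big_cat.
  by move=> v; rewrite mem_cat => /orP[/Cl|/Cl'].
- by move=> g; apply: tliftD (tens_pr_bal g).
move=> g h t [s Cs ->].
rewrite (big_morph _ (tliftD (tens_pr_bal g)) (tlift0 (tens_pr_bal g))).
have -> : (if g == h then \sum_(p <- s) p.1 *t p.2 else 0) =
          \sum_(p <- s) if g == h then p.1 *t p.2 else 0.
  by case: eqP => // _; rewrite big1.
apply: eq_big_seq => p /Cs [a [b [Ca Cb <-]]].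
rewrite (tlift_mk (tens_pr_bal g)) (tens_pr_homog g _ Ca) (gr_proj_homog _ _ Cb).
by rewrite subr_eq [b + a]addrC; case: eqP => // _; rewrite tmk0r.
Qed.

Lemma tens_compZ g h (t : T) (s : S) :
  tens_comp g t -> ring_comp h s -> tens_comp (g + h) ((s : S^c) *: t).
Proof.
case=> l Cl -> Cs; exists [seq (p.1, (s : S^c) *: p.2) | p <- l].
  move=> p /mapP[q /Cl [a [b [Ca Cb <-]]] ->]; exists a, (b + h).
  by rewrite addrA; split=> //; apply: mod_compZ.
by rewrite big_map scaler_sumr; apply: eq_bigr => p _; rewrite tmkZ.
Qed.

Definition grTens : grMod S := GrMod tens_grading tens_compZ.

End GradedTensor.

Section GradedTensorMap.
Variables (G : zmodType) (R S : grRing G) (M : grBimod R S).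
Variables (X Y : grMod R) (f : grHom X Y).

Lemma tens_map_deg g (t : grTens X M) :
  mod_comp g t -> mod_comp g (tens_map (gb_act M) f t : grTens Y M).
Proof.
case=> l Cl ->; exists [seq (f p.1, p.2) | p <- l].
  move=> p /mapP[q /Cl [a [b [Ca Cb ab]]] ->]; exists a, b.
  by split=> //; apply: gh_deg.
by rewrite big_map linear_sum; apply: eq_bigr => p _; rewrite /= tens_map_mk.
Qed.

Definition grTensMap : grHom (grTens X M) (grTens Y M) :=
  @GrHom G S (grTens X M) (grTens Y M) (tens_map (gb_act M) f) tens_map_deg.

End GradedTensorMap.

Record functor (G : zmodType) (R S : grRing G) := Functor {
  fobj :> grMod R -> grMod S;
  fmap : forall X Y, grHom X Y -> grHom (fobj X) (fobj Y);
  fmap_id : forall X, fmap (grId X) =1 id;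
  fmap_comp : forall X Y Z (g : grHom Y Z) (f : grHom X Y),
    fmap (grComp g f) =1 fmap g \o fmap f }.
Arguments fmap {G R S} _ [X Y] _.

Definition idF (G : zmodType) (R : grRing G) : functor R R :=
  @Functor G R R id (fun X Y f => f) (fun X x => erefl) (fun X Y Z g f x => erefl).

Section FunctorComp.
Variables (G : zmodType) (R S T : grRing G) (E : functor S T) (F : functor R S).

Lemma grHom_ext (R' : grRing G) (M N : grMod R') (f g : grHom M N) :
  f =1 g -> f = g.
Proof.
case: f g => [[f [[f1] [f2]]] df] [[g [[g1] [g2]]] dg] /= fg.
have {}fg : f = g by apply/funext.
subst g; rewrite (Prop_irrelevance g1 f1) (Prop_irrelevance g2 f2) => *.
by congr GrHom; apply: Prop_irrelevance.
Qed.

Lemma compF_id X : fmap E (fmap F (grId X)) =1 id.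
Proof.
rewrite (_ : fmap F (grId X) = grId (F X)); first exact: fmap_id.
by apply: grHom_ext => x; rewrite fmap_id.
Qed.

Lemma compF_comp X Y Z (g : grHom Y Z) (f : grHom X Y) :
  fmap E (fmap F (grComp g f)) =1 fmap E (fmap F g) \o fmap E (fmap F f).
Proof.
rewrite (_ : fmap F (grComp g f) = grComp (fmap F g) (fmap F f)).
  exact: fmap_comp.
by apply: grHom_ext => x; rewrite fmap_comp.
Qed.

Definition compF : functor R T :=
  @Functor G R T (fun X => E (F X)) (fun X Y f => fmap E (fmap F f))
    compF_id compF_comp.

End FunctorComp.

Definition shiftF (G : zmodType) (R : grRing G) (g : G) : functor R R :=
  @Functor G R R (shift g) (fun X Y f => shiftHom g f)
    (fun X x => erefl) (fun X Y Z g f x => erefl).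

Record grFunctor (G : zmodType) (R S : grRing G) := GrFunctor {
  gf_functor :> functor R S;
  gf_shift : forall g,
    compF gf_functor (shiftF R g) = compF (shiftF S g) gf_functor }.

Definition nat_iso (G : zmodType) (R S : grRing G) (E F : functor R S) : Prop :=
  exists (u : forall X, grHom (E X) (F X)) (v : forall X, grHom (F X) (E X)),
    [/\ forall X, cancel (u X) (v X), forall X, cancel (v X) (u X)
      & forall X Y (f : grHom X Y), u Y \o fmap E f =1 fmap F f \o u X].

Definition graded_equivalence (G : zmodType) (R S : grRing G) (F : grFunctor R S) :=
  exists E : grFunctor S R,
    nat_iso (compF E F) (idF R) /\ nat_iso (compF F E) (idF S).

(* [gf_shift] is an equality of functors (on objects and on morphisms).  It
   holds for $-\otimes_R M$, which commutes strictly with the shifts: the underlying modules of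
   $X(g) \otimes_R M$ and $(X \otimes_R M)(g)$ are convertible, and
   their gradings are equal. *)
Section TensorFunctor.
Variables (G : zmodType) (R S : grRing G) (M : grBimod R S).

Lemma tensF_id (X : grMod R) : grTensMap M (grId X) =1 id.
Proof.
elim/tens_ind => [|x m|t u IH1 IH2]; first exact: linear0.
  exact: tens_map_mk.
by rewrite linearD IH1 IH2.
Qed.

Lemma tensF_comp (X Y Z : grMod R) (g : grHom Y Z) (f : grHom X Y) :
  grTensMap M (grComp g f) =1 grTensMap M g \o grTensMap M f.
Proof.
elim/tens_ind => [|x m|t u IH1 IH2]; first by rewrite /= !linear0.
  by rewrite /= !tens_map_mk.
by rewrite [LHS]linearD IH1 IH2 /= !linearD.
Qed.

Definition tensF_functor : functor R S := Functor tensF_id tensF_comp.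

Lemma functor_eq (C : grMod R -> lmodType S^c)
    (D D' : forall X, G -> C X -> Prop)
    (gD : forall X, is_grading (D X)) (gD' : forall X, is_grading (D' X))
    (zD : forall X g h (x : C X) (s : S),
      D X g x -> ring_comp h s -> D X (g + h) ((s : S^c) *: x))
    (zD' : forall X g h (x : C X) (s : S),
      D' X g x -> ring_comp h s -> D' X (g + h) ((s : S^c) *: x))
    (f : forall X Y, grHom X Y -> {linear C X -> C Y})
    (df : forall X Y (h : grHom X Y) g x, D X g x -> D Y g (f X Y h x))
    (df' : forall X Y (h : grHom X Y) g x, D' X g x -> D' Y g (f X Y h x))
    i c i' c' :
  (forall X g x, D X g x <-> D' X g x) ->
  @Functor G R S (fun X => GrMod (gD X) (@zD X))
    (fun X Y h => @GrHom G S (GrMod (gD X) (@zD X)) (GrMod (gD Y) (@zD Y))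
       (f X Y h) (df X Y h)) i c =
  @Functor G R S (fun X => GrMod (gD' X) (@zD' X))
    (fun X Y h => @GrHom G S (GrMod (gD' X) (@zD' X)) (GrMod (gD' Y) (@zD' Y))
       (f X Y h) (df' X Y h)) i' c'.
Proof.
move=> DD'.
have eD : D = D'.
  by apply: functional_extensionality_dep => X; apply/funext => g; apply/funext => x; rewrite propeqE; apply: DD'.
subst D'.
have egD := Prop_irrelevance gD' gD; subst gD'.
have ezD := Prop_irrelevance zD' zD; subst zD'.
have edf := Prop_irrelevance df' df; subst df'.
by congr Functor; apply: Prop_irrelevance.
Qed.

Lemma tensF_shift g :
  compF tensF_functor (shiftF R g) = compF (shiftF S g) tensF_functor.
Proof.
apply: (@functor_eq (fun X => tens X (gb_act M)) _ _ _ _ _ _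
  (fun X Y h => tens_map (gb_act M) h)) => X h t; split=> -[l Cl ->].
  exists l => // p /Cl [a [b [Ca Cb <-]]]; exists (g + a), b.
  by rewrite addrA; split.
exists l => // p /Cl [a [b [Ca Cb ab]]]; exists (a - g), b.
split=> //=; first by rewrite addrC subrK.
by rewrite addrAC ab [g + h]addrC addrK.
Qed.

Definition tensF : grFunctor R S := GrFunctor tensF_shift.

End TensorFunctor.

Definition mkHom (G : zmodType) (R : grRing G) (M N : grMod R) (f : M -> N)
    (lf : linear f) (df : forall g x, mod_comp g x -> mod_comp g (f x)) : grHom M N :=
  @GrHom G R M N (HB.pack_for {linear M -> N} f
    (GRing.isLinear.Build R^c M N _ f lf)) df.

Section Projective.
Variables (G : zmodType) (R : grRing G).

Definition fin_gen (P : grMod R) : Prop :=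
  exists (n : nat) (e : 'I_n -> P), forall x, exists c : 'I_n -> R,
    x = \sum_i (c i : R^c) *: e i.

Definition gr_projective (P : grMod R) : Prop :=
  forall (M N : grMod R) (p : grHom M N) (f : grHom P N),
    (forall y, exists x, p x = y) -> exists g : grHom P M, p \o g =1 f.

Record fgpMod := FgpMod {
  fgp_mod :> grMod R;
  fgp_fg : fin_gen fgp_mod;
  fgp_proj : gr_projective fgp_mod }.

Section DirectSum.
Variables P Q : grMod R.

Definition sum_comp (g : G) (z : P * Q) : Prop :=
  mod_comp g z.1 /\ mod_comp g z.2.

Lemma sum_grading : is_grading sum_comp.
Proof.
have gP := mod_grading P; have gQ := mod_grading Q.
apply: (@grading_by_proj _ _ _ (fun g z => (gr_proj gP g z.1, gr_proj gQ g z.2))).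
- by move=> g; split; apply: grading0.
- by move=> g x y [x1 x2] [y1 y2]; split; apply: gradingB.
- case=> x y; have [l Cl xl] := grading_span gP x; have [l' Cl' yl'] := grading_span gQ y.
  exists ([seq (v, 0) | v <- l] ++ [seq (0, v) | v <- l']).
    move=> v; rewrite mem_cat => /orP[/mapP[w /Cl [g Cg] ->]|/mapP[w /Cl' [g Cg] ->]];
      by exists g; split=> //=; apply: grading0.
  rewrite big_cat !big_map [LHS]surjective_pairing /=.
  rewrite [RHS]surjective_pairing /= !(raddf_sum fst) !(raddf_sum snd) /=.
  congr (_, _); first by rewrite [X in _ + X]big1 ?addr0.
  by rewrite [X in X + _]big1 ?add0r.
- by move=> g x y; rewrite /= !gr_projD.
move=> g h [x y] [/= Cx Cy].
by rewrite (gr_proj_homog _ _ Cx) (gr_proj_homog _ _ Cy); case: eqP.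
Qed.

Lemma sum_compZ g h (z : (P * Q)%type) (r : R) :
  sum_comp g z -> ring_comp h r -> sum_comp (g + h) ((r : R^c) *: z).
Proof. by case=> z1 z2 Cr; split; apply: mod_compZ. Qed.

Definition grSum : grMod R := @GrMod G R (P * Q)%type sum_comp sum_grading sum_compZ.

Lemma sum_fst_linear : linear (fst : grSum -> P). Proof. by []. Qed.
Lemma sum_snd_linear : linear (snd : grSum -> Q). Proof. by []. Qed.
Definition sum_fst : grHom grSum P :=
  mkHom sum_fst_linear (fun g z Cz => proj1 Cz).
Definition sum_snd : grHom grSum Q :=
  mkHom sum_snd_linear (fun g z Cz => proj2 Cz).

Lemma sum_inl_linear : linear (fun x : P => (x, 0) : grSum).
Proof. by move=> r x y; congr (_, _); rewrite /= scaler0 addr0. Qed.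
Lemma sum_inr_linear : linear (fun x : Q => (0, x) : grSum).
Proof. by move=> r x y; congr (_, _); rewrite /= scaler0 addr0. Qed.
Definition sum_inl : grHom P grSum :=
  mkHom sum_inl_linear (fun g x Cx => conj Cx (grading0 (mod_grading Q) g)).
Definition sum_inr : grHom Q grSum :=
  mkHom sum_inr_linear (fun g x Cx => conj (grading0 (mod_grading P) g) Cx).

Section Pairing.
Variable N : grMod R.

Lemma sum_pair_linear (f : grHom N P) (g : grHom N Q) :
  linear (fun x : N => (f x, g x) : grSum).
Proof. by move=> r x y; rewrite !linearP. Qed.
Definition sum_pair (f : grHom N P) (g : grHom N Q) : grHom N grSum :=
  mkHom (sum_pair_linear f g) (fun h x Cx => conj (gh_deg f Cx) (gh_deg g Cx)).

Lemma sum_copair_linear (f : grHom P N) (g : grHom Q N) :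
  linear (fun z : grSum => f z.1 + g z.2).
Proof. by move=> r x y; rewrite /= !linearP scalerDr addrACA. Qed.
Lemma sum_copair_deg (f : grHom P N) (g : grHom Q N) h (z : grSum) :
  mod_comp h z -> mod_comp h (f z.1 + g z.2).
Proof. by case=> z1 z2; apply: (gradingD (mod_grading N)); apply: gh_deg. Qed.
Definition sum_copair (f : grHom P N) (g : grHom Q N) : grHom grSum N :=
  mkHom (sum_copair_linear f g) (@sum_copair_deg f g).

End Pairing.

Lemma sum_fg : fin_gen P -> fin_gen Q -> fin_gen grSum.
Proof.
move=> [m [e He]] [n [e' He']]; exists (m + n)%N.
exists (fun i => match split i with inl j => (e j, 0) | inr j => (0, e' j) end).
case=> x y; have [c xc] := He x; have [c' yc'] := He' y.
exists (fun i => match split i with inl j => c j | inr j => c' j end).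
rewrite big_split_ord /=.
under eq_bigr => i _ do rewrite (unsplitK (inl i : 'I_m + 'I_n)).
under [X in _ = _ + X]eq_bigr => i _ do rewrite (unsplitK (inr i : 'I_m + 'I_n)).
rewrite [RHS]surjective_pairing /= !(raddf_sum fst) !(raddf_sum snd) /=.
rewrite xc yc'; congr (_, _).
  by rewrite [X in _ + X]big1 ?addr0 // => i _; rewrite scaler0.
by rewrite [X in X + _]big1 ?add0r // => i _; rewrite scaler0.
Qed.

Lemma sum_proj : gr_projective P -> gr_projective Q -> gr_projective grSum.
Proof.
move=> hP hQ M N p f p_surj.
have [g pg] := hP M N p (grComp f sum_inl) p_surj.
have [h ph] := hQ M N p (grComp f sum_inr) p_surj.
exists (sum_copair g h) => -[x y] /=.
rewrite linearD; have /= -> := pg x; have /= -> := ph y.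
rewrite -linearD; congr (f _); apply: (congr2 pair); first exact: addr0.
exact: add0r.
Qed.

End DirectSum.

Definition zero_comp (g : G) (z : 'rV[R^c]_0) : Prop := True.

Lemma zero_grading : is_grading zero_comp.
Proof.
split=> // [x|s f _ _ _ g _]; last by apply/rowP => -[].
by exists [::]; rewrite ?big_nil //; apply/rowP => -[].
Qed.

Definition grZero : grMod R :=
  @GrMod G R 'rV[R^c]_0 zero_comp zero_grading (fun _ _ _ _ _ _ => I).

Lemma zero_eq (x y : grZero) : x = y. Proof. by apply/rowP => -[]. Qed.

Lemma zero_fg : fin_gen grZero.
Proof. by exists 0%N, (fun _ => 0) => x; exists (fun _ => 0); apply: zero_eq. Qed.

Lemma zero_hom_linear (M N : grMod R) : linear (fun _ : M => 0 : N).
Proof. by move=> r x y; rewrite scaler0 addr0. Qed.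
Definition zero_hom (M N : grMod R) : grHom M N :=
  mkHom (@zero_hom_linear M N) (fun g _ _ => grading0 (mod_grading N) g).

Lemma zero_proj : gr_projective grZero.
Proof.
move=> M N p f _; exists (zero_hom grZero M) => x /=.
by rewrite linear0 (zero_eq x 0) linear0.
Qed.

Lemma iso_sum (P P' Q Q' : grMod R) :
  gr_iso P P' -> gr_iso Q Q' -> gr_iso (grSum P Q) (grSum P' Q').
Proof.
case=> f [f' [ff f'f]] [h [h' [hh h'h]]].
exists (sum_pair (grComp f (sum_fst P Q)) (grComp h (sum_snd P Q))).
exists (sum_pair (grComp f' (sum_fst P' Q')) (grComp h' (sum_snd P' Q'))).
by split=> -[x y] /=; rewrite ?ff ?f'f ?hh ?h'h.
Qed.

Lemma iso_sumC (P Q : grMod R) : gr_iso (grSum P Q) (grSum Q P).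
Proof.
exists (sum_pair (sum_snd P Q) (sum_fst P Q)).
exists (sum_pair (sum_snd Q P) (sum_fst Q P)).
by split=> -[x y].
Qed.

Lemma iso_sumA (P Q T : grMod R) :
  gr_iso (grSum P (grSum Q T)) (grSum (grSum P Q) T).
Proof.
pose a := sum_fst P (grSum Q T); pose b := sum_snd P (grSum Q T).
pose c := sum_fst (grSum P Q) T; pose d := sum_snd (grSum P Q) T.
exists (sum_pair (sum_pair a (grComp (sum_fst Q T) b)) (grComp (sum_snd Q T) b)).
exists (sum_pair (grComp (sum_fst P Q) c) (sum_pair (grComp (sum_snd P Q) c) d)).
by split=> [[x [y z]]|[[x y] z]].
Qed.

Lemma iso_sum0 (P : grMod R) : gr_iso (grSum grZero P) P.
Proof.
exists (sum_snd grZero P), (sum_inr grZero P).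
by split=> [[x y]|y] //; rewrite /= (zero_eq x 0).
Qed.

Definition fgpSum (P Q : fgpMod) : fgpMod :=
  FgpMod (sum_fg (fgp_fg P) (fgp_fg Q)) (sum_proj (@fgp_proj P) (@fgp_proj Q)).
Definition fgpZero : fgpMod := FgpMod zero_fg zero_proj.

End Projective.

(* Quotients and monoids are developed on bare types: the isomorphism classes
   of graded modules live in a larger universe than the carriers of the
   [zmodType]s, so [K0gr] below cannot be a [zmodType]. *)
Definition quot (T : Type) (E : T -> T -> Prop) : Type :=
  {C : T -> Prop | exists x, C = E x}.

Section Quot.
Variables (T : Type) (E : T -> T -> Prop).
Hypothesis E_refl : forall x, E x x.
Hypothesis E_sym : forall x y, E x y -> E y x.
Hypothesis E_trans : forall x y z, E x y -> E y z -> E x z.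

Definition qpi (x : T) : quot E := exist _ (E x) (ex_intro _ x erefl).
Definition qrepr (q : quot E) : T := sval (cid (svalP q)).

Lemma quot_eq (q q' : quot E) : sval q = sval q' -> q = q'.
Proof.
case: q q' => [C p] [C' p'] /= eC; subst C'.
by rewrite (Prop_irrelevance p p').
Qed.

Lemma qreprK q : qpi (qrepr q) = q.
Proof. by apply: quot_eq; rewrite /=; rewrite /qrepr; case: cid. Qed.

Lemma qpiP x y : qpi x = qpi y <-> E x y.
Proof.
split=> [[->]|xy]; first exact: E_refl.
apply: quot_eq; apply/funext => z /=; rewrite propeqE.
by split; apply: E_trans => //; apply: E_sym.
Qed.

Lemma qrepr_pi x : E (qrepr (qpi x)) x.
Proof. by apply/qpiP; rewrite qreprK. Qed.

End Quot.

Record comMonoid := ComMonoid {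
  cm_sort :> Type;
  cm_add : cm_sort -> cm_sort -> cm_sort;
  cm_zero : cm_sort;
  cm_addA : associative cm_add;
  cm_addC : commutative cm_add;
  cm_add0 : left_id cm_zero cm_add }.

Section Completion.
Variable A : comMonoid.
Local Notation "x +' y" := (cm_add x y) (at level 50, left associativity).

(* [(a, b)] stands for $a - b$. *)
Definition compl_eq (x y : A * A) : Prop :=
  exists e, x.1 +' y.2 +' e = y.1 +' x.2 +' e.

HB.instance Definition _ := Monoid.isComLaw.Build A (cm_zero A) (@cm_add A)
  (@cm_addA A) (@cm_addC A) (@cm_add0 A).

Lemma cm_addAC : right_commutative (@cm_add A).
Proof. by move=> x y z; rewrite -!cm_addA (cm_addC y). Qed.
Lemma cm_addACA : interchange (@cm_add A) (@cm_add A).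
Proof. by move=> x y z t; rewrite !cm_addA (cm_addAC x). Qed.

Lemma compl_refl x : compl_eq x x. Proof. by exists (cm_zero A). Qed.
Lemma compl_sym x y : compl_eq x y -> compl_eq y x.
Proof. by move=> [e xy]; exists e. Qed.
Lemma compl_trans x y z : compl_eq x y -> compl_eq y z -> compl_eq x z.
Proof.
case: x y z => [a b] [c d] [a' b'] [e /= h1] [f /= h2]; exists (c +' d +' e +' f) => /=.
transitivity ((a +' d +' e) +' (c +' b' +' f)).
  by rewrite !cm_addA (ACl (1*4*5*3*2*6)).
by rewrite h1 h2 !cm_addA (ACl (4*2*1*5*3*6)).
Qed.

Definition completion : Type := quot compl_eq.
Definition cpi (x : A * A) : completion := qpi compl_eq x.

Lemma cpiP x y : cpi x = cpi y <-> compl_eq x y.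
Proof. exact: qpiP compl_refl compl_sym compl_trans x y. Qed.

Lemma cpi_repr (q : completion) : cpi (qrepr q) = q.
Proof. exact: qreprK. Qed.

Definition compl_add (q r : completion) : completion :=
  cpi ((qrepr q).1 +' (qrepr r).1, (qrepr q).2 +' (qrepr r).2).
Definition compl_zero : completion := cpi (cm_zero A, cm_zero A).
Definition compl_opp (q : completion) : completion :=
  cpi ((qrepr q).2, (qrepr q).1).

Lemma compl_addE x y : compl_add (cpi x) (cpi y) = cpi (x.1 +' y.1, x.2 +' y.2).
Proof.
apply/cpiP; have /cpiP [e /= he] := cpi_repr (cpi x).
have /cpiP [f /= hf] := cpi_repr (cpi y); exists (e +' f) => /=.
set a := qrepr _ in he *; set b := qrepr _ in hf *.
transitivity ((a.1 +' x.2 +' e) +' (b.1 +' y.2 +' f)).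
  by rewrite !cm_addA (ACl (1*3*5*2*4*6)).
by rewrite he hf !cm_addA (ACl (1*4*2*5*3*6)).
Qed.

Lemma compl_addA : associative compl_add.
Proof.
move=> p q r; rewrite -[p]cpi_repr -[q]cpi_repr -[r]cpi_repr.
by rewrite !compl_addE /= !cm_addA.
Qed.

Lemma compl_addC : commutative compl_add.
Proof.
move=> p q; rewrite -[p]cpi_repr -[q]cpi_repr !compl_addE.
by rewrite cm_addC (cm_addC (qrepr p).2).
Qed.

Lemma compl_add0 : left_id compl_zero compl_add.
Proof.
by move=> p; rewrite -[p]cpi_repr compl_addE /= !cm_add0 -surjective_pairing.
Qed.

Lemma compl_addN : left_inverse compl_zero compl_opp compl_add.
Proof.
move=> p; rewrite /compl_opp -[X in compl_add _ X]cpi_repr compl_addE /=.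
by apply/cpiP; exists (cm_zero A); rewrite /= !cm_addA (ACl (3*2*1*4)).
Qed.

Definition of_monoid (a : A) : completion := cpi (a, cm_zero A).

End Completion.

Record comMonoidHom (A B : comMonoid) := ComMonoidHom {
  mh_fun :> A -> B;
  mh_add : {morph mh_fun : x y / cm_add x y} }.

Section CompletionMap.
Variables (A B : comMonoid) (f : comMonoidHom A B).

Definition compl_map (q : completion A) : completion B :=
  cpi (f (qrepr q).1, f (qrepr q).2).

Lemma compl_mapE x : compl_map (cpi x) = cpi (f x.1, f x.2).
Proof.
apply/cpiP; have /cpiP [e /= he] := cpi_repr (cpi x).
by exists (f e); rewrite /= -!mh_add he.
Qed.

Lemma compl_mapD : {morph compl_map : p q / compl_add p q}.
Proof.
move=> p q; rewrite -[p]cpi_repr -[q]cpi_repr compl_addE !compl_mapE compl_addE.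
by rewrite /= !mh_add.
Qed.

End CompletionMap.

Section K0.
Variables (G : zmodType) (R : grRing G).

Definition fgp_iso (P Q : fgpMod R) : Prop := gr_iso P Q.

Definition Vgr_car : Type := quot fgp_iso.
Definition iso_class (P : fgpMod R) : Vgr_car := qpi fgp_iso P.

Lemma iso_classP P Q : iso_class P = iso_class Q <-> gr_iso P Q.
Proof.
apply: qpiP => [P'|P' Q'|P' Q' T]; [exact: gr_iso_refl|exact: gr_iso_sym|].
exact: gr_iso_trans.
Qed.

Lemma iso_class_repr (q : Vgr_car) : iso_class (qrepr q) = q.
Proof. exact: qreprK. Qed.

Definition Vgr_add (p q : Vgr_car) : Vgr_car :=
  iso_class (fgpSum (qrepr p) (qrepr q)).

Lemma Vgr_addE P Q : Vgr_add (iso_class P) (iso_class Q) = iso_class (fgpSum P Q).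
Proof. by apply/iso_classP; apply: iso_sum; apply/iso_classP; rewrite iso_class_repr. Qed.

Lemma Vgr_addA : associative Vgr_add.
Proof.
move=> p q r; rewrite -[p]iso_class_repr -[q]iso_class_repr -[r]iso_class_repr.
by rewrite !Vgr_addE; apply/iso_classP; apply: iso_sumA.
Qed.
Lemma Vgr_addC : commutative Vgr_add.
Proof.
move=> p q; rewrite -[p]iso_class_repr -[q]iso_class_repr.
by rewrite !Vgr_addE; apply/iso_classP; apply: iso_sumC.
Qed.
Lemma Vgr_add0 : left_id (iso_class (fgpZero R)) Vgr_add.
Proof.
move=> p; rewrite -[p]iso_class_repr Vgr_addE.
by apply/iso_classP; apply: iso_sum0.
Qed.

Definition Vgr : comMonoid := ComMonoid Vgr_addA Vgr_addC Vgr_add0.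

Definition K0gr : Type := completion Vgr.
Definition K0class (P : fgpMod R) : K0gr := of_monoid (iso_class P : Vgr).

End K0.

Definition additive_functor (G : zmodType) (R S : grRing G) (F : functor R S) :=
  forall (X Y : grMod R) (f g h : grHom X Y),
    (forall x, h x = f x + g x) -> forall y, fmap F h y = fmap F f y + fmap F g y.

Definition preserves_fgp (G : zmodType) (R S : grRing G) (F : functor R S) :=
  forall P : fgpMod R, fin_gen (F P) /\ gr_projective (F P).

Section K0Map.
Variables (G : zmodType) (R S : grRing G) (F : functor R S).
Hypotheses (F_add : additive_functor F) (F_fgp : preserves_fgp F).

Definition fgpF (P : fgpMod R) : fgpMod S :=
  FgpMod (proj1 (F_fgp P)) (proj2 (F_fgp P)).

Lemma fmap_idE (X : grMod R) (f : grHom X X) : f =1 id -> fmap F f =1 id.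
Proof.
move=> f1 x; rewrite -[RHS](@fmap_id _ _ _ F X); congr (fmap F _ _).
exact: grHom_ext.
Qed.

Lemma fmapK (X Y : grMod R) (f : grHom X Y) (g : grHom Y X) :
  cancel f g -> cancel (fmap F f) (fmap F g).
Proof.
move=> fg x; have /= <- := @fmap_comp _ _ _ F _ _ _ g f x.
by rewrite fmap_idE.
Qed.

Lemma functor_iso (X Y : grMod R) : gr_iso X Y -> gr_iso (F X) (F Y).
Proof.
by case=> f [g [fg gf]]; exists (fmap F f), (fmap F g); split; apply: fmapK.
Qed.

Lemma fmap0 (X Y : grMod R) (f : grHom X Y) :
  (forall x, f x = 0) -> forall y, fmap F f y = 0.
Proof.
move=> f0 y; apply: (addrI (fmap F f y)); rewrite addr0.
by rewrite -(F_add (h := f)) // => x; rewrite !f0 addr0.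
Qed.

Lemma functor_sum (X Y : grMod R) : gr_iso (F (grSum X Y)) (grSum (F X) (F Y)).
Proof.
exists (sum_pair (fmap F (sum_fst X Y)) (fmap F (sum_snd X Y))).
exists (sum_copair (fmap F (sum_inl X Y)) (fmap F (sum_inr X Y))).
have FC (A B C : grMod R) (g : grHom B C) (f : grHom A B) x :
    fmap F g (fmap F f x) = fmap F (grComp g f) x by rewrite fmap_comp.
split=> [z|[x y]] /=.
  rewrite !FC -(F_add (h := grId _)) ?fmap_id // => -[x y] /=.
  by rewrite /= -[LHS]/(x, y); apply: (congr2 pair); rewrite ?addr0 ?add0r.
rewrite !linearD !FC; apply: (congr2 pair).
  by rewrite fmap_idE // fmap0 // addr0.
by rewrite fmap0 // fmap_idE // add0r.
Qed.

Definition Vgr_map_fun (q : Vgr R) : Vgr S := iso_class (fgpF (qrepr q)).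

Lemma Vgr_mapE P : Vgr_map_fun (iso_class P) = iso_class (fgpF P).
Proof.
by apply/iso_classP; apply: functor_iso; apply/iso_classP; apply: iso_class_repr.
Qed.

Lemma Vgr_mapD : {morph Vgr_map_fun : p q / cm_add p q}.
Proof.
move=> p q; rewrite -[p]iso_class_repr -[q]iso_class_repr /= Vgr_addE.
by rewrite !Vgr_mapE Vgr_addE; apply/iso_classP; apply: functor_sum.
Qed.

Definition Vgr_map : comMonoidHom (Vgr R) (Vgr S) := ComMonoidHom Vgr_mapD.

Definition K0_map : K0gr R -> K0gr S := compl_map Vgr_map.

Lemma Vgr_map0 : Vgr_map (cm_zero (Vgr R)) = cm_zero (Vgr S).
Proof.
rewrite /= Vgr_mapE; apply/iso_classP.
exists (zero_hom _ _), (zero_hom _ _); split=> x /=; last exact: zero_eq.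
rewrite -[RHS](@fmap_id _ _ _ F); apply/esym/fmap0 => y; exact: zero_eq.
Qed.

Lemma K0_map_class P : K0_map (K0class P) = K0class (fgpF P).
Proof.
apply: etrans (compl_mapE Vgr_map (iso_class P : Vgr R, cm_zero (Vgr R))) _.
exact: (congr2 (fun a b : Vgr S => cpi (a, b)) (Vgr_mapE P) Vgr_map0).
Qed.

End K0Map.

Section TensorK0.
Variables (G : zmodType) (R S : grRing G).

Lemma tensF_add (M : grBimod R S) : additive_functor (tensF M).
Proof.
move=> X Y f g h hfg; elim/tens_ind => [|x m|t u IH1 IH2].
- by rewrite !linear0 addr0.
- by rewrite /= !tens_map_mk hfg tmkDl.
by rewrite !linearD IH1 IH2 addrACA.
Qed.

Section Pull.
Variable xi : grRingHom R S.
Variable N : grMod S.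

Definition pull_car : Type := let _ := xi in N.
HB.instance Definition _ := GRing.Zmodule.on pull_car.

Definition pull_scale (r : R^c) (n : pull_car) : pull_car :=
  ((xi (r : R) : S) : S^c) *: (n : N).
Lemma pull_scaleA r s n : pull_scale r (pull_scale s n) = pull_scale (r * s) n.
Proof. by rewrite /pull_scale scalerA; congr (_ *: _); rewrite [RHS]rmorphM. Qed.
Lemma pull_scale1 : left_id 1 pull_scale.
Proof. by move=> n; rewrite /pull_scale [xi _]rmorph1 scale1r. Qed.
Lemma pull_scaleDr : right_distributive pull_scale +%R.
Proof. by move=> r m n; rewrite /pull_scale scalerDr. Qed.
Lemma pull_scaleDl n : {morph pull_scale^~ n : r s / r + s}.
Proof. by move=> r s; rewrite /pull_scale -scalerDl; congr (_ *: _); rewrite [LHS]rmorphD. Qed.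
HB.instance Definition _ := GRing.Zmodule_isLmodule.Build R^c pull_car
  pull_scaleA pull_scale1 pull_scaleDr pull_scaleDl.

Lemma pull_compZ g h (n : pull_car) (r : R) :
  mod_comp g (n : N) -> ring_comp h r -> mod_comp (g + h) (((r : R^c) *: n : pull_car) : N).
Proof. by move=> Cn Cr; apply: mod_compZ => //; apply: rh_deg. Qed.

Definition grPull : grMod R :=
  @GrMod G R pull_car (fun g n => mod_comp g (n : N)) (mod_grading N) pull_compZ.

End Pull.

Section Adjunction.
Variables (M : grBimod R S) (phi : grHom M (grReg S)) (psi : grHom (grReg S) M).
Hypotheses (phiK : cancel phi psi) (psiK : cancel psi phi).

Lemma iso_ring_hom : exists xi : grRingHom R S,
  forall (r : R) (m : M), (phi (gb_act M r m) : S) = xi r * (phi m : S).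
Proof.
pose e : M := psi (1 : S).
have eE (m : M) : m = ((phi m : S) : S^c) *: e.
  by rewrite -linearZ -[LHS]phiK; congr (psi _); rewrite [RHS]mul1r.
pose f (r : R) : S := phi (gb_act M r e).
have fP r m : (phi (gb_act M r m) : S) = f r * (phi m : S).
  by rewrite {1}[m]eE lactZ linearZ.
have fB : zmod_morphism f.
  move=> r s; apply/eqP; rewrite eq_sym subr_eq eq_sym; apply/eqP.
  by rewrite -[LHS]linearD -lactDl subrK.
have f1 : monoid_morphism f.
  split=> [|r s]; first by rewrite /f lact1 psiK.
  by rewrite {1}/f lactA fP.
pose F : {rmorphism R -> S} := HB.pack_for {rmorphism R -> S} f
  (GRing.isZmodMorphism.Build R S f fB) (GRing.isMonoidMorphism.Build R S f f1).
have e0 : mod_comp 0 e.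
  apply: gh_deg; exact: ring_comp1.
have fd g r : ring_comp g r -> ring_comp g (F r).
  move=> Cr; apply: (gh_deg phi); rewrite -[g]addr0; exact: gb_deg.
by exists (GrRingHom fd).
Qed.

Variable xi : grRingHom R S.
Hypothesis xiP : forall (r : R) (m : M), (phi (gb_act M r m) : S) = xi r * (phi m : S).

Variables (X : grMod R) (N : grMod S) (f : grHom X (grPull xi N)).

Definition adj_pure (x : X) (m : M) : N := (phi m : S^c) *: (f x : N).

Lemma adj_bal : balanced (gb_act M) adj_pure.
Proof.
split=> [x y m|x m n|x r m]; rewrite /adj_pure.
- by rewrite linearD scalerDr.
- by rewrite linearD scalerDl.
by rewrite xiP linearZ [LHS]scalerA.
Qed.

Lemma adj_linear : linear (tlift adj_pure : tens X (gb_act M) -> N).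
Proof.
move=> s t u; rewrite (tliftD adj_bal); congr (_ + _).
elim/tens_ind: t => [|x m|t v IH1 IH2].
- by rewrite scaler0 (tlift0 adj_bal) scaler0.
- by rewrite tmkZ !(tlift_mk adj_bal) /adj_pure linearZ scalerA.
by rewrite scalerDr !(tliftD adj_bal) IH1 IH2 scalerDr.
Qed.

Lemma adj_deg g (t : grTens X M) : mod_comp g t -> mod_comp g (tlift adj_pure t).
Proof.
case=> s Cs ->.
rewrite (big_morph _ (tliftD adj_bal) (tlift0 adj_bal)).
apply: (grading_sum (mod_grading N)) => p /Cs [h [k [Ch Ck <-]]] _.
by rewrite (tlift_mk adj_bal); apply: mod_compZ; apply: gh_deg.
Qed.

Definition adj : grHom (grTens X M) N :=
  @mkHom G S (grTens X M) N (tlift adj_pure) adj_linear adj_deg.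

End Adjunction.

Lemma tensF_fgp (M : grBimod R S) :
  gr_iso M (grReg S) -> preserves_fgp (tensF M).
Proof.
case=> phi [psi [phiK psiK]] P.
have [xi xiP] := iso_ring_hom phiK psiK.
pose e : M := psi (1 : S).
have eE (m : M) : m = ((phi m : S) : S^c) *: e.
  by rewrite -linearZ -[LHS]phiK; congr (psi _); rewrite [RHS]mul1r.
split.
  have [n [b bP]] := fgp_fg P; exists n, (fun i => tmk (gb_act M) (b i) e).
  elim/tens_ind => [|x m|t u [c ->] [d ->]].
  - by exists (fun _ => 0); rewrite big1 // => i _; rewrite scale0r.
  - have [c ->] := bP x; exists (fun i => xi (c i) * (phi m : S)).
    rewrite tmk_suml; apply: eq_bigr => i _.
    by rewrite tmkA [in LHS](eE (gb_act M _ m)) xiP tmkZ.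
  exists (fun i => c i + d i); rewrite -big_split; apply: eq_bigr => i _.
  by rewrite /= -scalerDl.
move=> N N' p f p_surj.
pose pp := mkHom (M := grPull xi N) (N := grPull xi N') (f := p)
  (fun r => linearP p (xi r : S^c)) (fun g x Cx => gh_deg p Cx).
have f0_lin : linear (fun x : P => f (tmk (gb_act M) x e) : grPull xi N').
  move=> r x y; rewrite tmkDl linearD tmkA (eE (gb_act M _ e)) xiP.
  by rewrite [phi e]psiK mulr1 -tmkZ linearZ.
have f0_deg g x : mod_comp g x ->
    mod_comp g (f (tmk (gb_act M) x e) : grPull xi N').
  move=> Cx; apply: (gh_deg f); rewrite -[g]addr0; apply: tens_comp_mk => //.
  by apply: gh_deg; apply: ring_comp1.
have [g0 pg0] := @fgp_proj _ _ P _ _ pp (mkHom f0_lin f0_deg) p_surj.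
exists (adj xiP g0) => t.
elim/tens_ind: t => [|x m|t u IH1 IH2]; first by rewrite !linear0.
  rewrite /= (tlift_mk (adj_bal xiP g0)) /adj_pure linearZ.
  have /= -> := pg0 x; by rewrite -linearZ tmkZ -eE.
by rewrite !linearD; congr (_ + _).
Qed.

Definition K0_tens (M : grBimod R S) (hM : gr_iso M (grReg S)) :
    K0gr R -> K0gr S :=
  K0_map (@tensF_add M) (tensF_fgp hM).

Definition K0_ringHom (xi : grRingHom R S) : K0gr R -> K0gr S :=
  @K0_tens (grRes xi) (gr_iso_refl (grReg S)).

End TensorK0.

(* Main.v *)
From HB Require Import structures.
Require Import Defs.
From mathcomp Require Import all_boot all_algebra.

Set Implicit Arguments.
Unset Strict Implicit.
Unset Printing Implicit Defensive.

Import GRing.Theory.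
Local Open Scope ring_scope.

(** Why the theorem is true.  A right [S]-linear isomorphism [phi : M -> S]
    sends the left action of [r] to a right [S]-linear endomorphism of [S],
    and such an endomorphism is left multiplication by the image of 1: call it
    [xi r].  This is the ring homomorphism of [iso_ring_hom], and [phi] becomes
    an isomorphism of bimodules from [M] to [S] with [R] acting through [xi].
    Hence [X ⊗ M] and [X ⊗ S] are graded isomorphic for all [X]
    ([tens_bimod_iso]), so the two functors have the same effect on isomorphism
    classes, and so on [K_0].

    Suppose now that [- ⊗ M] is a graded equivalence, so that it is full and
    faithful on degree-preserving homomorphisms.  An element [r] of degree [g]
    is the same thing as the homomorphism [x |-> r * x] from [R(-g)] to [R], and
    up to the identifications [R(-g) ⊗ M = S(-g)] and [R ⊗ M = S] the
    functor turns it into left multiplication by [xi r].  Thus [xi] is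
    injective on elements of degree [g] because the functor is faithful
    ([rh_homog_inj]), and every element of degree [g] in [S] is attained, by an
    element of degree [g], because the functor is full ([rh_homog_surj]).
    Bijectivity in each degree gives a graded isomorphism
    ([gr_ring_iso_homog]). *)

Section FullyFaithful.
Variables (G : zmodType) (R S : grRing G) (F : functor R S) (E : functor S R).
Hypothesis EF : nat_iso (compF E F) (idF R).

(** Naturality of [EF = id] writes [f] as a conjugate of [E (F f)], which is
    determined by [F f]. *)
Lemma left_inverse_faithful (X Y : grMod R) (f g : grHom X Y) :
  fmap F f =1 fmap F g -> f =1 g.
Proof.
case: EF => u [v [_ vK nat_u]] /grHom_ext Ffg x.
rewrite -(vK X x); have /= <- := nat_u _ _ f (v X x).
by rewrite Ffg; have /= <- := nat_u _ _ g (v X x).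
Qed.

End FullyFaithful.

Lemma equivalence_full (G : zmodType) (R S : grRing G)
    (F : functor R S) (E : functor S R) :
  nat_iso (compF E F) (idF R) -> nat_iso (compF F E) (idF S) ->
  forall (X Y : grMod R) (g : grHom (F X) (F Y)),
  exists f : grHom X Y, fmap F f =1 g.
Proof.
case=> u [v [uK vK nat_u]] FE X Y g.
(* The only candidate is [E g] transported along the natural isomorphism;
   [F f] and [g] then have the same image under the faithful functor [E]. *)
pose f := grComp (u Y) (grComp (fmap E g) (v X)); exists f.
apply: (left_inverse_faithful FE) => z; apply: (can_inj (uK Y)).
by have /= -> := nat_u _ _ f z; rewrite /= uK.
Qed.

Section TensorHom.
Variables (G : zmodType) (R S : grRing G) (X : grMod R) (M : grBimod R S).
Variables (N : grMod S) (b : X -> M -> N).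
Hypothesis b_bal : balanced (gb_act M) b.
Hypothesis bZ : forall x (s : S) m, b x ((s : S^c) *: m) = (s : S^c) *: b x m.
Hypothesis b_deg : forall g h x m,
  mod_comp g x -> mod_comp h m -> mod_comp (g + h) (b x m).

(** The additive map induced by [b] is right [S]-linear and preserves degrees
    because the first property can be tested on pure tensors and the second on
    pure tensors of homogeneous elements. *)
Lemma tens_hom : exists f : grHom (grTens X M) N,
  forall x m, f (tmk (gb_act M) x m) = b x m.
Proof.
have lin : linear (tlift b : tens X (gb_act M) -> N).
  move=> s t u; rewrite (tliftD b_bal); congr (_ + _).
  elim/tens_ind: t => [|x m|t v IH1 IH2].
  - by rewrite scaler0 (tlift0 b_bal) scaler0.
  - by rewrite tmkZ !(tlift_mk b_bal) bZ.
  by rewrite scalerDr !(tliftD b_bal) IH1 IH2 scalerDr.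
have deg g (t : grTens X M) : mod_comp g t -> mod_comp g (tlift b t).
  case=> l Cl ->; rewrite (big_morph _ (tliftD b_bal) (tlift0 b_bal)).
  apply: (grading_sum (mod_grading N)) => p /Cl [h [k [Ch Ck <-]]] _.
  by rewrite (tlift_mk b_bal); apply: b_deg.
exists (@mkHom G S (grTens X M) N (tlift b) lin deg) => x m.
exact: tlift_mk b_bal x m.
Qed.

End TensorHom.

Section BimoduleMap.
Variables (G : zmodType) (R S : grRing G) (X : grMod R) (M N : grBimod R S).

Lemma tens_bimod_map (phi : grHom M N) :
  (forall r m, phi (gb_act M r m) = gb_act N r (phi m)) ->
  exists f : grHom (grTens X M) (grTens X N),
    forall x m, f (tmk (gb_act M) x m) = tmk (gb_act N) x (phi m).
Proof.
move=> phiA; apply: tens_hom => [|x s m|g h x m Cx Cm].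
- split=> [x y m|x m n|x r m]; first exact: tmkDl.
    by rewrite linearD tmkDr.
  by rewrite phiA tmkA.
- by rewrite linearZ tmkZ.
by apply: tens_comp_mk => //; apply: gh_deg.
Qed.

End BimoduleMap.

Lemma tens_bimod_iso (G : zmodType) (R S : grRing G) (X : grMod R)
    (M N : grBimod R S) (phi : grHom M N) (psi : grHom N M) :
  cancel phi psi -> cancel psi phi ->
  (forall r m, phi (gb_act M r m) = gb_act N r (phi m)) ->
  gr_iso (grTens X M) (grTens X N).
Proof.
move=> phiK psiK phiA.
have psiA r n : psi (gb_act N r n) = gb_act M r (psi n).
  by rewrite -{1}(psiK n) -phiA phiK.
have [f fE] := tens_bimod_map X phiA; have [g gE] := tens_bimod_map X psiA.
exists f, g; split; elim/tens_ind => [|x m|t u IH1 IH2].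
- by rewrite !linear0.
- by rewrite fE gE phiK.
- by rewrite !linearD IH1 IH2.
- by rewrite !linear0.
- by rewrite gE fE psiK.
by rewrite !linearD IH1 IH2.
Qed.

(** A map on [K_0] only depends on the isomorphism classes of the images of the
    objects. *)
Lemma K0_tens_iso (G : zmodType) (R S : grRing G) (M N : grBimod R S)
    (hM : gr_iso M (grReg S)) (hN : gr_iso N (grReg S)) :
  (forall X : grMod R, gr_iso (grTens X M) (grTens X N)) ->
  K0_tens hM =1 K0_tens hN.
Proof.
move=> iso q; apply: (congr2 (fun a b : Vgr S => cpi (a, b)));
  by apply/iso_classP; apply: iso.
Qed.

(** Degrees separate: the homogeneous components of [r] have images of distinct
    degrees, so they vanish one by one when [xi r = 0].  The inverse preserves
    degrees because a homogeneous element has a preimage of its own degree, and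
    by injectivity no other. *)
Lemma gr_ring_iso_homog (G : zmodType) (R S : grRing G) (xi : grRingHom R S) :
  (forall g r, ring_comp g r -> xi r = 0 -> r = 0) ->
  (forall g s, ring_comp g s -> exists2 r, ring_comp g r & xi r = s) ->
  gr_ring_iso xi.
Proof.
move=> inj_h surj_h; have gR := ring_grading R.
have inj0 r : xi r = 0 -> r = 0.
  have rE := gr_sum_proj (gr_supp_uniq gR r) (fun _ h => h).
  rewrite [in xi r]rE rmorph_sum => xir0; rewrite rE big1_seq // => g /andP[_ gr].
  apply: (inj_h g); first exact: gr_projP.
  apply: (grading_free (ring_grading S) (gr_supp_uniq gR r) _ xir0) => // h.
  by apply: rh_deg; apply: gr_projP.
have inj : injective xi.
  by move=> x y xy; apply/subr0_eq/inj0; rewrite rmorphB xy subrr.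
have surj s : exists r, xi r = s.
  elim/(grading_ind (ring_grading S)): s => [|s t [r <-] [r' <-]|g s Cs].
  - by exists 0; rewrite rmorph0.
  - by exists (r + r'); rewrite rmorphD.
  by have [r _ rs] := surj_h g s Cs; exists r.
pose z s := sval (boolp.cid (surj s)).
have zK : cancel z xi by move=> s; rewrite /z; case: boolp.cid.
have Kz : cancel xi z by move=> r; apply: inj; rewrite zK.
have zB : zmod_morphism z by move=> s t; apply: inj; rewrite rmorphB !zK.
have zM : monoid_morphism z.
  by split=> [|s t]; apply: inj; rewrite ?rmorph1 ?rmorphM !zK.
pose Z : {rmorphism S -> R} := HB.pack_for {rmorphism S -> R} z
  (GRing.isZmodMorphism.Build S R z zB) (GRing.isMonoidMorphism.Build S R z zM).
have Zdeg g s : ring_comp g s -> ring_comp g (Z s).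
  by case/surj_h => r Cr <-; rewrite /= Kz.
by exists (GrRingHom Zdeg).
Qed.

Section TensorEquivalence.
Variables (G : zmodType) (R S : grRing G) (M : grBimod R S).
Variables (phi : grHom M (grReg S)) (psi : grHom (grReg S) M).
Hypotheses (phiK : cancel phi psi) (psiK : cancel psi phi).
Variable xi : grRingHom R S.
Hypothesis xiP : forall (r : R) (m : M),
  (phi (gb_act M r m) : S) = xi r * (phi m : S).

(** The shift by [- g] makes left multiplication by an element of degree [g]
    preserve degrees. *)
Lemma lmul_hom g (r : R) : ring_comp g r ->
  exists f : grHom (shift (- g) (grReg R)) (grReg R), forall x : R, f x = r * x.
Proof.
move=> Cr; pose f (x : shift (- g) (grReg R)) : grReg R := r * (x : R).
have lin : linear f by move=> a x y; rewrite /f /= mulrDr [r * (a *: x)]mulrA.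
have deg h x : mod_comp h x -> mod_comp h (f x).
  by move=> Cx; rewrite -[h](addNKr g); apply: ring_compM.
by exists (mkHom lin deg).
Qed.

Lemma tmk1 (x : R) m : tmk (gb_act M) (x : grReg R) m =
  tmk (gb_act M) (1 : grReg R) (gb_act M x m).
Proof. by rewrite -tmkA; congr (tmk _ _ _); rewrite [RHS]mul1r. Qed.

(** If [xi r = 0] then [r] kills [M], so tensoring left multiplication by [r]
    gives 0; faithfulness then makes that multiplication itself 0, and its value
    at 1 is [r]. *)
Lemma rh_homog_inj g (r : R) :
  (forall (X Y : grMod R) (f f' : grHom X Y),
     fmap (tensF M) f =1 fmap (tensF M) f' -> f =1 f') ->
  ring_comp g r -> xi r = 0 -> r = 0.
Proof.
move=> faith Cr xir0; have [f fE] := lmul_hom Cr.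
rewrite -[r]mulr1 -fE; apply: (faith _ _ f (zero_hom _ _)).
elim/tens_ind => [|x m|t u IH1 IH2]; first by rewrite !linear0.
  rewrite /= !tens_map_mk /= fE tmk0l tmk1 -[gb_act _ _ _]phiK xiP.
  by rewrite rmorphM xir0 !mul0r linear0 tmk0r.
by rewrite !linearD IH1 IH2.
Qed.

(** Left multiplication by [s] on [S] is a homomorphism [R(-g) ⊗ M -> R ⊗ M].
    By fullness it comes from a homomorphism [f : R(-g) -> R], which is left
    multiplication by [f 1], and [f 1] is the preimage of [s]. *)
Lemma rh_homog_surj g (s : S) :
  (forall (X Y : grMod R) (h : grHom (tensF M X) (tensF M Y)),
     exists f : grHom X Y, fmap (tensF M) f =1 h) ->
  ring_comp g s -> exists2 r, ring_comp g r & xi r = s.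
Proof.
move=> full Cs.
(* In terms of [R ⊗ M = M = S], the map [t |-> s * t]; the element
     [x ⊗ m] stands for [phi (x m)]. *)
have [h hE] : exists h : grHom (grTens (shift (- g) (grReg R)) M)
    (grTens (grReg R) M), forall x m, h (tmk (gb_act M) x m) =
  tmk (gb_act M) (1 : grReg R) (psi (s * (phi (gb_act M (x : R) m) : S))).
  apply: tens_hom => [|x t m|a b x m Cx Cm].
  - split=> [x y m|x m n|x r m].
    + by rewrite lactDl linearD mulrDr linearD tmkDr.
    + by rewrite lactDr linearD mulrDr linearD tmkDr.
    by rewrite -lactA.
  - rewrite lactZ tmkZ -[in RHS]linearZ [phi _]linearZ; congr (tmk _ _ _).
    by congr (psi _); apply: (mulrA s).
  rewrite -[a + b]add0r; apply: tens_comp_mk; first exact: ring_comp1.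
  apply: gh_deg; have -> : a + b = g + ((- g + a) + b) by rewrite !addrA subrr add0r.
  by apply: ring_compM => //; apply: gh_deg; apply: gb_deg.
have [f fE] := full _ _ h.
(* The identification of [R ⊗ M] with [S] recovers [s] from [h]. *)
have [ev evE] : exists ev : grHom (grTens (grReg R) M) (grReg S),
    forall (x : R) m, ev (tmk (gb_act M) (x : grReg R) m) = phi (gb_act M x m).
  apply: tens_hom => [|x t m|a b x m Cx Cm].
  - split=> [x y m|x m n|x r m]; rewrite ?lactDl ?lactDr ?linearD //.
    by rewrite -lactA.
  - by rewrite lactZ linearZ.
  by apply: gh_deg; apply: gb_deg.
exists (f (1 : R)).
  by apply: (gh_deg f); rewrite /= addNr; apply: ring_comp1.
have := fE (tmk (gb_act M) (1 : shift (- g) (grReg R)) (psi (1 : S))).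
rewrite hE /= tens_map_mk => /(congr1 ev).
by rewrite !evE !lact1 !psiK mulr1 xiP psiK mulr1.
Qed.

End TensorEquivalence.

Theorem proposition3p1 (Gamma : zmodType) (R S : grRing Gamma)
    (M : grBimod R S) (hM : gr_iso M (grReg S)) :
  exists xi : grRingHom R S,
    K0_ringHom xi =1 K0_tens hM /\
    (graded_equivalence (tensF M) -> gr_ring_iso xi).
Proof.
have [phi [psi [phiK psiK]]] := hM.
have [xi xiP] := iso_ring_hom phiK psiK.
exists xi; split=> [|[E [EF FE]]].
  apply: K0_tens_iso => X; apply: gr_iso_sym.
  exact: (@tens_bimod_iso _ _ _ X M (grRes xi) phi psi).
apply: gr_ring_iso_homog => [g r|g s].
  exact: (rh_homog_inj phiK xiP (left_inverse_faithful EF)).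
exact: (rh_homog_surj psiK xiP (equivalence_full EF FE)).
Qed.
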